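(* Let $g:[0,\infty)\to[0,\infty)$ be a concave function such that $g(x)=0$ if and only if $x=0$, and let $d(x,y)=g(|x-y|)$ for $x,y\in\mathbf{R}$. Let $n\ge 1$ and let $x_1<x_2<\dots<x_{2n}$ be real numbers. For indices $1\le i<j\le 2n$ of opposite parity let $W_{i,j}$ be the weight of a minimum-weight perfect matching on the $j-i+1$ points $x_i<x_{i+1}<\dots<x_j$. Extend this notation by the ''initial conditions'' $$W_{i,i-1}=0\quad(1\le i\le 2n+1),\qquad W_{i+2,i-1}=-d(x_i,x_{i+1})\quad(1\le i\le 2n-1).$$ Then for all indices $i,j$ of opposite parity with $1\le i<j\le 2n$, $$W_{i,j}=\min\bigl[\,d(x_i,x_j)+W_{i+1,j-1},\ W_{i,j-2}+W_{i+2,j}-W_{i+2,j-2}\,\bigr].$$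
   Context: A perfect matching on a finite set $S\subset\mathbf{R}$ of even cardinality is a partition of $S$ into two-element sets (arcs); its weight is the sum of $d(a,b)$ over its arcs $\{a,b\}$. A minimum-weight perfect matching on $S$ is one whose weight is minimal among all perfect matchings on $S$. *)

(* Defs.v *)
From HB Require Import structures.
From mathcomp Require Import all_boot all_order all_algebra finmap.
From mathcomp Require Import all_classical all_reals all_analysis.
Set Implicit Arguments.
Unset Strict Implicit.
Unset Printing Implicit Defensive.
Import Order.TTheory GRing.Theory Num.Theory.
Local Open Scope ring_scope.
Local Open Scope fset_scope.

Definition concave_function (R : realType) (D : set R) (f : R -> R) : Prop :=
  convex_function (D : set (convex_lmodType R^o)) (fun x => - f x).

Definition dist_of (R : realType) (g : R -> R) (x y : R) : R := g `|x - y|.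

Definition perfect_matching (R : realType) (S : {fset R})
    (M : {fset {fset R}}) : bool :=
  [&& fcover M == S, trivIfset M & all (fun A : {fset R} => #|` A| == 2%N) M].

(* Each arc {a, b} is counted once, as the ordered pair with a < b. *)
Definition weight (R : realType) (d : R -> R -> R) (M : {fset {fset R}}) : R :=
  \sum_(A <- M) \sum_(a <- A) \sum_(b <- A | a < b) d a b.

Definition min_weight_matching (R : realType) (d : R -> R -> R)
    (S : {fset R}) (M : {fset {fset R}}) : Prop :=
  perfect_matching S M /\
  forall M', perfect_matching S M' -> weight d M <= weight d M'.

(* The weight of a chosen minimum-weight perfect matching; it is 0 by default
   when #|` S| is odd. *)
Definition min_weight (R : realType) (d : R -> R -> R) (S : {fset R}) : R :=
  weight d (xget fset0 [set M | min_weight_matching d S M]%classic).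

Definition points (R : realType) (x : nat -> R) (i j : nat) : {fset R} :=
  [fset x k | k in index_iota i j.+1].

(* Points and indices are numbered from 1. The second and third branches are
   W_(i, i-1) = 0 and W_(i+2, i-1) = - d(x_i, x_(i+1)), written in terms of the
   second index; the last branch is never used. *)
Definition W (R : realType) (d : R -> R -> R) (x : nat -> R) (i j : nat) : R :=
  if (i < j)%N then min_weight d (points x i j)
  else if i == j.+1 then 0
  else if i == j.+3 then - d (x j.+1) (x j.+2)
  else 0.

Section Facts.
Variables (R : realType) (d : R -> R -> R).
Implicit Types (S : {fset R}) (M : {fset {fset R}}).

Lemma weight_arc (a b : R) : a < b -> weight d [fset [fset a; b]] = d a b.
Proof.
move=> ab; have nab : a \notin [fset b] by rewrite inE lt_eqF.
rewrite /weight big_seq_fset1 big_fsetU1 //= big_seq_fset1 !big_mkcond /=.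
rewrite !big_fsetU1 //= !big_seq_fset1 !ltxx ab big_mkcond /=.
by rewrite !big_fsetU1 //= !big_seq_fset1 ltxx lt_gtF // !addr0 add0r.
Qed.

Lemma perfect_matching_exists S : ~~ odd #|` S| -> exists M, perfect_matching S M.
Proof.
have [k] := ubnP #|` S|; elim: k S => // k IH S; rewrite ltnS => leSk evS.
have [->|[a aS]] := fset_0Vmem S.
  exists fset0; rewrite /perfect_matching /fcover /trivIfset /fcover.
  by rewrite !big_seq_fset0 cardfs0 !eqxx; apply/allP => A; rewrite inE.
have cS : #|` S| = (#|` S `\ a|).+1 by rewrite (cardfsD1 a S) aS.
have [Sa0|[b bSa]] := fset_0Vmem (S `\ a).
  by move: evS; rewrite cS Sa0 cardfs0.
have cS2 : #|` S| = (#|` S `\ a `\ b|).+2.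
  by rewrite cS (cardfsD1 b (S `\ a)) bSa.
have [||M /and3P[/eqP cM tM aM]] := IH (S `\ a `\ b).
- by rewrite cS2 in leSk; apply: leq_trans leSk.
- by move: evS; rewrite cS2 /= negbK.
move: (bSa); rewrite !inE => /andP[ba bS].
have dis A : A \in M -> [disjoint [fset a; b] & A].
  move=> AM; rewrite -fsetI_eq0; apply/eqP/fsetP => t.
  rewrite !inE; apply/negP => /andP[tab tA].
  have : t \in fcover M by apply/bigfcupP; exists A => //; rewrite AM.
  by rewrite cM !inE; case/orP: tab => /eqP ->; rewrite eqxx ?andbF.
have nM : [fset a; b] \notin M.
  apply/negP => /dis; rewrite -fsetI_eq0 fsetIid => /eqP /fsetP /(_ a).
  by rewrite !inE eqxx.
exists ([fset a; b] |` M); apply/and3P; split.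
- rewrite /fcover big_fsetU1 //= -/(fcover M) cM; apply/eqP/fsetP => t.
  rewrite !inE; have [->|] /= := eqVneq t a; first by rewrite aS.
  by have [->|] /= := eqVneq t b; rewrite ?bS.
- apply/trivIfsetP => A B; rewrite !inE.
  case/orP=> [/eqP->|AM]; case/orP=> [/eqP->|BM] AB; first by rewrite eqxx in AB.
  + exact: dis.
  + by rewrite fdisjoint_sym; exact: dis.
  + by move/trivIfsetP: tM; apply.
- apply/allP => A; rewrite !inE => /orP[/eqP->|/(allP aM)//].
  by rewrite cardfs2 [a == b]eq_sym ba.
Qed.

Lemma min_weight_matching_exists S : ~~ odd #|` S| ->
  exists M, min_weight_matching d S M.
Proof.
move=> /perfect_matching_exists[M0 M0S].
pose P := [fset M in fpowerset (fpowerset S) | perfect_matching S M].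
have PP M : perfect_matching S M -> M \in P.
  move=> MS; rewrite !inE MS andbT fpowersetE; apply/fsubsetP => A AM.
  case/and3P: MS => /eqP <- _ _; rewrite fpowersetE.
  by apply/fsubsetP => t tA; apply/bigfcupP; exists A => //; rewrite AM.
case: (@arg_minP _ _ _ [` PP _ M0S] xpredT (fun M : P => weight d (val M))) => //.
move=> M _ minM; exists (val M); split=> [|M' M'S].
  by have := valP M; rewrite !inE => /andP[].
exact: (minM [` PP _ M'S]).
Qed.

Lemma min_weightP S M : min_weight_matching d S M -> min_weight d S = weight d M.
Proof.
move=> hM; have [h1 h2] : min_weight_matching d S
  (xget fset0 [set M | min_weight_matching d S M]%classic).
  exact: (xgetI fset0 hM).
by case: hM => hM1 hM2; apply/le_anti; rewrite h2 ?hM2.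
Qed.

Lemma W_pred (x : nat -> R) (i : nat) : (1 <= i)%N -> W d x i (i - 1) = 0.
Proof. by case: i => // i _; rewrite /W subn1 /= ltnNge leqnSn /= eqxx. Qed.

Lemma W_init (x : nat -> R) (i : nat) :
  (1 <= i)%N -> W d x (i + 2) (i - 1) = - d (x i) (x (i + 1)%N).
Proof.
case: i => // i _; rewrite /W subn1 addn2 addn1 succnK.
have /negbTE -> : ~~ (i.+3 < i)%N by rewrite -leqNgt !leqW.
have /negbTE -> : i.+3 != i.+1 by rewrite gtn_eqF.
by rewrite eqxx.
Qed.

End Facts.

(* Main.v *)
Require Import Defs.
From HB Require Import structures.
From mathcomp Require Import all_boot all_order all_algebra finmap zify lra.
From mathcomp Require Import all_classical all_reals all_analysis.
Import Order.TTheory GRing.Theory Num.Theory.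
Local Open Scope ring_scope.

(** If a < c < b < e, then concavity gives d(a,e) + d(c,b) <= d(a,b) + d(c,e):
    replacing two crossing arcs by the nested pair does not increase the weight.
    Uncrossing the arc of the leftmost point x_i shows that W(i,j) is attained
    by an arc {x_i, x_k} together with optimal matchings of the points inside
    and of the points to the right of it; iterating, the same holds for the
    last point.  By induction on lengths, comparing the first arc on [i,j] with
    the last arc on [i',j'], one gets the quadrangle inequality
      W(i,j') + W(i',j) <= W(i,j) + W(i',j')   (i <= i' <= j + 1, j <= j').
    For i' = i+2 it says that W(i,j) is at most the second term of the minimum.
    Conversely, if x_i is matched to x_k with k < j, then
    W(i,j) = W(i,k) + W(k+1,j), and the quadrangle inequality for [i,k] and
    [i+2,j-2] yields
      W(i,j) + W(i+2,j-2) >= W(i,j-2) + W(i+2,k) + W(k+1,j)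
                          >= W(i,j-2) + W(i+2,j). *)

(** * Perfect matchings: unions, restrictions, uncrossing the arc of the least point *)

Section Matchings.
Variables (R : realType) (d : R -> R -> R).
Implicit Types (S T A : {fset R}) (M : {fset {fset R}}).
Local Open Scope fset_scope.
Local Open Scope ring_scope.

Lemma weightU M1 M2 : [disjoint M1 & M2] ->
  weight d (M1 `|` M2) = weight d M1 + weight d M2.
Proof.
move=> /fdisjointP dis; rewrite /weight (big_fsetID _ (mem M1)) /=.
congr (_ + _); apply: eq_fbigl => A; rewrite !inE /=.
  by case: (A \in M1); rewrite ?andbF.
by have [/dis/negbTE ->|] := boolP (A \in M1); rewrite ?andbF ?andbT.
Qed.

Lemma perfect_matching_arc S M A : perfect_matching S M -> A \in M ->
  exists a b, [/\ a < b, A = [fset a; b], a \in S & b \in S].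
Proof.
case/and3P => /eqP <- _ /allP h AM; have cA := h _ AM.
have sA t : t \in A -> t \in fcover M.
  by move=> tA; apply/bigfcupP; exists A; rewrite ?AM.
move/eqP in cA.
have [a aA] : exists a, a \in A.
  by apply/fset0Pn; rewrite -cardfs_eq0 cA.
have : #|` A `\ a| = 1%N by have := cardfsD1 a A; rewrite aA cA => -[].
move=> /eqP/cardfs1P[b hb].
have : b \in A `\ a by rewrite hb inE.
rewrite !inE => /andP[ba bA].
have eA : A = [fset a; b] by rewrite -(fsetD1K aA) hb.
have [ab|ab|ab] := ltgtP a b.
- by exists a, b; split; rewrite ?sA.
- by exists b, a; split; rewrite ?sA // fsetUC.
- by rewrite ab eqxx in ba.
Qed.

Lemma perfect_matching0 M : perfect_matching fset0 M -> M = fset0.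
Proof.
move=> hM; apply/fsetP => A; rewrite inE; apply/negP.
by case/(perfect_matching_arc _ _ _ hM) => a [b [_ _]]; rewrite inE.
Qed.

Lemma perfect_matching_even S M : perfect_matching S M -> ~~ odd #|` S|.
Proof.
case/and3P => /eqP <- /eqP <- /allP h.
rewrite big_seq; elim/big_ind: _ => // [m n hm hn|A /h /eqP -> //].
by rewrite oddD (negbTE hm) (negbTE hn).
Qed.

Lemma perfect_matching_pair (a b : R) : a != b ->
  perfect_matching [fset a; b] [fset [fset a; b]].
Proof.
move=> ab; apply/and3P; split.
- by rewrite /fcover big_seq_fset1.
- by apply/trivIfsetP => A B; rewrite !inE => /eqP-> /eqP->; rewrite eqxx.
- by apply/allP => A; rewrite inE => /eqP ->; rewrite cardfs2 ab.
Qed.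

Lemma perfect_matchingU S T M1 M2 : [disjoint S & T] ->
  perfect_matching S M1 -> perfect_matching T M2 ->
  [disjoint M1 & M2] /\ perfect_matching (S `|` T) (M1 `|` M2).
Proof.
move=> /fdisjointP dST h1 h2.
have [[/eqP c1 t1 a1] [/eqP c2 t2 a2]] := (and3P h1, and3P h2).
have dis A B : A \in M1 -> B \in M2 -> [disjoint A & B].
  move=> AM BM; apply/fdisjointP => t tA; apply/negP => tB.
  have : t \in S by rewrite -c1; apply/bigfcupP; exists A; rewrite ?AM.
  move=> /dST /negP; apply.
  by rewrite -c2; apply/bigfcupP; exists B; rewrite ?BM.
split.
  (* An arc common to [M1] and [M2] would be disjoint from itself, whereas arcs are nonempty. *)
  apply/fdisjointP => A AM; apply/negP => /(dis _ _ AM) /fdisjointP h.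
  have [a [b [_ eA _ _]]] := perfect_matching_arc _ _ _ h1 AM.
  by have := h a; rewrite eA !inE eqxx => /(_ isT).
apply/and3P; split.
- apply/eqP/fsetP => t; rewrite -c1 -c2 !inE; apply/bigfcupP/orP.
    move=> [A]; rewrite !inE andbT => /orP[] AM tA; [left|right];
    by apply/bigfcupP; exists A; rewrite ?AM.
  by move=> [] /bigfcupP[A /andP[AM _] tA]; exists A; rewrite // !inE AM ?orbT.
- apply/trivIfsetP => A B; rewrite !inE => /orP[] AM /orP[] BM.
  + exact: (trivIfsetP _ t1).
  + by move=> _; apply: dis.
  + by move=> _; rewrite fdisjoint_sym; apply: dis.
  + exact: (trivIfsetP _ t2).
- by apply/allP => A; rewrite !inE => /orP[/(allP a1)|/(allP a2)].
Qed.

Lemma perfect_matchingD S M M1 : perfect_matching S M -> M1 `<=` M ->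
  [/\ perfect_matching (fcover M1) M1,
      perfect_matching (S `\` fcover M1) (M `\` M1) &
      weight d M = weight d M1 + weight d (M `\` M1)].
Proof.
case/and3P => /eqP <- /trivIfsetP t a /fsubsetP s; split.
- apply/and3P; split=> //.
    by apply/trivIfsetP => A B /s AM /s BM; apply: t.
  by apply/allP => A /s /(allP a).
- apply/and3P; split.
  + apply/eqP/fsetP => x; rewrite inE; apply/bigfcupP/andP.
      move=> [A]; rewrite inE andbT => /andP[AM1 AM] xA; split.
        apply/negP => /bigfcupP[B /andP[BM1 _] xB].
        have /t : A != B by apply/eqP => eAB; rewrite eAB BM1 in AM1.
        by move=> /(_ AM (s _ BM1)) /fdisjointP /(_ _ xA); rewrite xB.
      by apply/bigfcupP; exists A; rewrite ?AM.
    move=> [/negP nx /bigfcupP[A /andP[AM _] xA]]; exists A => //.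
    rewrite inE AM !andbT; apply/negP => AM1; apply: nx.
    by apply/bigfcupP; exists A; rewrite ?AM1.
  + by apply/trivIfsetP => A B; rewrite !inE => /andP[_ AM] /andP[_ BM]; apply: t.
  + by apply/allP => A; rewrite inE => /andP[_ /(allP a)].
- rewrite -weightU; last by apply/fdisjointP => A AM1; rewrite inE AM1.
  congr weight; apply/fsetP => A; rewrite !inE.
  by have [/s|] := boolP (A \in M1).
Qed.

Lemma min_weight_le S M : perfect_matching S M -> min_weight d S <= weight d M.
Proof.
move=> hM; have [M0 hM0] :=
  @min_weight_matching_exists R d S (perfect_matching_even _ _ hM).
by rewrite (min_weightP hM0); apply: hM0.2.
Qed.

Lemma min_weight_attained S : ~~ odd #|` S| ->
  exists2 M, perfect_matching S M & weight d M = min_weight d S.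
Proof.
move=> /(min_weight_matching_exists d)[M hM]; exists M; first exact: hM.1.
by rewrite (min_weightP hM).
Qed.

Lemma min_weight0 : min_weight d fset0 = 0.
Proof.
have [|M /perfect_matching0 -> <-] := min_weight_attained fset0.
  by rewrite cardfs0.
by rewrite /weight big_seq_fset0.
Qed.

Lemma min_weight_pair (a b : R) : a < b -> min_weight d [fset a; b] <= d a b.
Proof.
move=> ab; rewrite -weight_arc //; apply/min_weight_le/perfect_matching_pair.
by rewrite lt_eqF.
Qed.

Lemma min_weightU S T : [disjoint S & T] -> ~~ odd #|` S| -> ~~ odd #|` T| ->
  min_weight d (S `|` T) <= min_weight d S + min_weight d T.
Proof.
move=> dST /min_weight_attained[M hM <-] /min_weight_attained[M' hM' <-].
have [dM hU] := perfect_matchingU _ _ _ _ dST hM hM'.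
by rewrite -weightU // min_weight_le.
Qed.

(** An arc through a point of [T] is not disjoint from [T], hence lies in it. So the arcs contained
    in [T] match exactly [T], the other arcs match the rest of [S], and each family weighs at least
    the corresponding minimum. *)
Lemma min_weight_split S T M : perfect_matching S M -> T `<=` S ->
  (forall A, A \in M -> A `<=` T \/ [disjoint A & T]) ->
  [/\ ~~ odd #|` T|, ~~ odd #|` S `\` T| &
      min_weight d T + min_weight d (S `\` T) <= weight d M].
Proof.
move=> hM /fsubsetP sTS cl; pose M1 := [fset A in M | A `<=` T].
have [|] := perfect_matchingD _ _ M1 hM.
  by apply/fsubsetP => A; rewrite !inE => /andP[].
have -> : fcover M1 = T.
  apply/fsetP => t; apply/bigfcupP/idP => [[A]|tT].
    by rewrite !inE andbT => /andP[_ /fsubsetP h] /h.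
  have : t \in fcover M by case/and3P: hM => /eqP -> _ _; apply: sTS.
  case/bigfcupP => A /andP[AM _] tA; exists A => //.
  rewrite !inE AM andbT /=; case: (cl A AM) => // /fdisjointP /(_ _ tA).
  by rewrite tT.
move=> h1 h2 ->; split; first exact: perfect_matching_even h1.
- exact: perfect_matching_even h2.
- by apply: lerD; apply: min_weight_le.
Qed.

Lemma perfect_matchingD1 S M (a b : R) : perfect_matching S M ->
  [fset a; b] \in M -> a < b ->
  perfect_matching (S `\` [fset a; b]) (M `\ [fset a; b]) /\
  weight d M = d a b + weight d (M `\ [fset a; b]).
Proof.
move=> hM abM ab.
have [|_ h2 ->] := perfect_matchingD _ _ [fset [fset a; b]] hM.
  by rewrite fsub1set.
by move: h2; rewrite weight_arc // {1}/fcover big_seq_fset1.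
Qed.

Hypothesis d_cross : forall a c b e, a < c -> c < b -> b < e ->
  d a e + d c b <= d a b + d c e.

(* Uncrossing an arc {c, e} that crosses {a, b} pairs the least point a with the
   later point e, so after finitely many steps no arc crosses that of a. *)
Lemma min_weight_first_arc S M (a b : R) : perfect_matching S M ->
  [fset a; b] \in M -> a < b -> (forall t, t \in S -> a <= t) ->
  exists e, let I := [fset t in S | a < t < e] in
    let O := [fset t in S | e < t] in
    [/\ e \in S, a < e, ~~ odd #|` I|, ~~ odd #|` O| &
        d a e + min_weight d I + min_weight d O <= weight d M].
Proof.
have [m] := ubnP #|` [fset t in S | b < t]|.
elim: m M b => // m IH M b ltm hM abM ab aS.
have abS t : t \in [fset a; b] -> t \in S.
  case/and3P: hM => /eqP <- _ _ tab; apply/bigfcupP.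
  by exists [fset a; b]; rewrite ?abM.
have aS' : a \in S by rewrite abS // !inE eqxx.
have bS : b \in S by rewrite abS // !inE eqxx orbT.
have [hM1 wM] := perfect_matchingD1 _ _ _ _ hM abM ab.
set M1 := M `\ _ in hM1 wM.
have [[c [e [ceM ac cb be]]]|ncross] := pselect (exists c e,
    [/\ [fset c; e] \in M1, a < c, c < b & b < e]).
  have ce : c < e by apply: lt_trans be.
  have [hM2 wM1] := perfect_matchingD1 _ _ _ _ hM1 ceM ce.
  set M2 := M1 `\ _ in hM2 wM1.
  have inS t : t \in [fset c; e] -> t \in S `\` [fset a; b].
    case/and3P: hM1 => /eqP <- _ _ tce; apply/bigfcupP.
    by exists [fset c; e]; rewrite ?ceM.
  have cS : c \in S by have := inS c; rewrite !inE eqxx => /(_ isT) /andP[].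
  have eS : e \in S by have := inS e; rewrite !inE eqxx orbT => /(_ isT) /andP[].
  have ae : a < e by apply: lt_trans be.
  have ncb : c != b by rewrite lt_eqF.
  have nae : a != e by rewrite lt_eqF.
  have [|d1 p1] := perfect_matchingU _ _ _ _ _ (perfect_matching_pair _ _ ncb) hM2.
    apply/fdisjointP => t; rewrite !inE.
    by case/orP => /eqP ->; rewrite eqxx ?orbT ?andbF.
  have [|d2 p2] := perfect_matchingU _ _ _ _ _ (perfect_matching_pair _ _ nae) p1.
    apply/fdisjointP => t; rewrite !inE.
    case/orP => /eqP ->; rewrite eqxx ?orbT ?andbF ?orbF /=.
      by rewrite (lt_eqF ac) (lt_eqF ab).
    by rewrite (gt_eqF ce) (gt_eqF be).
  (* Exchanging {a,b}, {c,e} for {a,e}, {c,b} keeps the set of matched points. *)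
  have eqS : [fset a; e] `|` ([fset c; b] `|`
      (S `\` [fset a; b] `\` [fset c; e])) = S.
    apply/fsetP => t; rewrite !inE.
    have [->|_] /= := eqVneq t a; first by rewrite aS'.
    have [->|_] /= := eqVneq t e; first by rewrite eS.
    have [->|_] /= := eqVneq t c; first by rewrite cS.
    by have [->|_] /= := eqVneq t b; first by rewrite bS.
  rewrite eqS in p2.
  (* The partner of [a] is now [e > b], so fewer points lie beyond it; the induction is on that
     number. *)
  have [||||f hf] := IH _ e _ p2.
  - rewrite -ltnS; apply: leq_trans ltm; rewrite ltnS;
      apply: fproper_ltn_card; rewrite fproperE.
    apply/andP; split; first by apply/fsubsetP => t;
      rewrite !inE => /andP[->]; apply: lt_trans.
    by apply/fsubsetPn; exists e; rewrite !inE eS // ltxx.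
  - by rewrite !inE eqxx.
  - done.
  - done.
  exists f; case: hf => h1 h2 h3 h4 h5; split=> //; apply: le_trans h5 _.
  rewrite weightU // weightU // !weight_arc // wM wM1.
  have := d_cross _ _ _ _ ac cb be; lra.
(* Since [a] is least and no arc crosses {a,b}, every other arc lies in [I] or beyond [b], so
   [min_weight_split] applies with [I]. *)
exists b => I O.
have eO : S `\` [fset a; b] `\` I = O.
  apply/fsetP => t; rewrite !inE; have [tS|] := boolP (t \in S); last first.
    by rewrite !andbF.
  have [->|nta] := eqVneq t a; first by rewrite (lt_gtF ab) /= !andbF.
  have -> : a < t by rewrite lt_neqAle eq_sym nta aS.
  by case: (ltgtP t b).
have [||oI oO] := min_weight_split _ I _ hM1.
- apply/fsubsetP => t; rewrite !inE => /andP[-> /andP[h1 h2]].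
  by rewrite (gt_eqF h1) (lt_eqF h2).
- move=> A AM1.
  have [c [e [ce eA]]] := perfect_matching_arc _ _ _ hM1 AM1.
  rewrite !inE !negb_or => /andP[/andP[ca cb] cS] /andP[/andP[ea eb] eS].
  have ac : a < c by rewrite lt_neqAle eq_sym ca aS.
  have ae : a < e by apply: lt_trans ce.
  have [eltb|bltee|eqeb] := ltgtP e b; last by rewrite eqeb eqxx in eb.
    left; apply/fsubsetP => t; rewrite eA !inE => /orP[] /eqP ->.
      by rewrite cS ac (lt_trans ce).
    by rewrite eS ae.
  right; apply/fdisjointP => t; rewrite eA !inE => /orP[] /eqP ->; last first.
    by rewrite (lt_gtF bltee) !andbF.
  rewrite cS ac /= -leNgt leNgt; apply/negP => cltb.
  by apply: ncross; exists c, e; rewrite -eA.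
rewrite eO in oO *; move=> hle; split=> //.
rewrite wM; move: hle; lra.
Qed.

End Matchings.

Ltac clear_parity :=
  repeat match goal with H : context [odd _] |- _ => clear H end.

Ltac parity :=
  repeat match goal with H : ?p |- _ =>
    match p with
    | odd _ = odd _ => move: H
    | odd _ = ~~ odd _ => move: H
    | _ => clear H
    end end;
  rewrite /=;
  repeat match goal with |- context [odd ?a] => case: (odd a) end;
  by [].

(** Side conditions are either parity equalities, decided by cases on each [odd] term, or index
    inequalities, given to [lia] without the parity facts. *)
Ltac side := solve [parity | clear_parity; lia].

(** * The quadrangle inequality and the recursion for an abstract interval function *)

Section IntervalRecursion.
(* [v i j] stands for W_(i, j-1) and [c i j] for the weight of the arc joining
   the points of indices i and j. *)
Variables (R : realDomainType) (v c : nat -> nat -> R) (N : nat).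
Hypothesis v_empty : forall i, v i i = 0.
Hypothesis v_cat : forall i k j, (1 <= i <= k)%N -> (k <= j <= N)%N ->
  odd k = odd i -> odd j = odd i -> v i j <= v i k + v k j.
Hypothesis v_arc : forall i j, (1 <= i <= j)%N -> (j < N)%N ->
  odd j = ~~ odd i -> v i j.+1 <= c i j + v i.+1 j.
Hypothesis v_first : forall i j, (1 <= i < j)%N -> (j <= N)%N ->
  odd j = odd i -> exists k, [/\ (i < k < j)%N, odd k = ~~ odd i &
    c i k + v i.+1 k + v k.+1 j <= v i j].
Hypothesis c_cross : forall i l k j, (1 <= i < l)%N -> (l < k < j)%N ->
  (j < N)%N -> c i j + c l k <= c i k + c l j.

(** No mirrored uncrossing is needed: [v_first] is iterated on the block right of the first arc
    until an arc reaches [j]. The blocks passed on the way are glued into [v i l] by [v_arc] and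
    [v_cat]. *)
Lemma v_last i j : (1 <= i <= j)%N -> (j < N)%N -> odd j = ~~ odd i ->
  exists l, [/\ (i <= l <= j)%N, odd l = odd i &
    v i l + c l j + v l.+1 j <= v i j.+1].
Proof.
have [m] := ubnP (j - i); elim: m i => // m IH i ltm hi jN pij.
have [k [ik pik hk]] := @v_first i j.+1 ltac:(side) ltac:(side) ltac:(side).
have [ekj|nkj] := eqVneq k j.
  exists i; split; [lia|done|].
  by rewrite v_empty add0r; move: hk; rewrite ekj v_empty addr0.
have [||||l [hl pl hle]] := IH k.+1; try side.
exists l; split; [side|side|].
have := @v_cat i k.+1 l ltac:(side) ltac:(side) ltac:(side) ltac:(side).
have := @v_arc i k ltac:(side) ltac:(side) ltac:(side).
lra.
Qed.

(** Induction on the total length of the two right-hand intervals. The cases follow the position of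
    the first arc {i,k} of the one relative to the last arc {l,j'} of the other. *)
Lemma v_quadrangle i i' j j' : (1 <= i <= i')%N -> (i' <= j)%N ->
  (j <= j' <= N)%N -> odd i' = odd i -> odd j = odd i -> odd j' = odd i ->
  v i j' + v i' j <= v i j + v i' j'.
Proof.
have [m] := ubnP ((j - i) + (j' - i')).
elim: m i i' j j' => // m IH i i' j j' ltm hi hij hj pi pj pj'.
have [->|ni] := eqVneq i i'; first by rewrite addrC.
have [->//|nj] := eqVneq j j'.
have [->|nij] := eqVneq i' j.
  by rewrite v_empty addr0; apply: v_cat; side.
case: j' => [|j'] in ltm hj pj' nj *; first by lia.
have [k [hk pk lek]] := @v_first i j ltac:(side) ltac:(side) ltac:(side).
have [l [hl pl lel]] := @v_last i' j' ltac:(side) ltac:(side) ltac:(side).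
have arc_ik := @v_arc i k ltac:(side) ltac:(side) ltac:(side).
have arc_lj := @v_arc l j' ltac:(side) ltac:(side) ltac:(side).
(* The block [i,k] lies left of [i']: it splits off, and [k.+1] replaces [i]. *)
have [ki|ik] := ltnP k i'.
  have := IH k.+1 i' j j'.+1 ltac:(side) ltac:(side) ltac:(side) ltac:(side)
    ltac:(side) ltac:(side) ltac:(side).
  have := @v_cat i k.+1 j'.+1 ltac:(side) ltac:(side) ltac:(side) ltac:(side).
  lra.
(* Mirror case: the block [l,j'] lies beyond the first interval and splits off on the right. *)
have [jl|lj] := leqP j l.
  have := IH i i' j l ltac:(side) ltac:(side) ltac:(side) ltac:(side)
    ltac:(side) ltac:(side) ltac:(side).
  have := @v_cat i l j'.+1 ltac:(side) ltac:(side) ltac:(side) ltac:(side).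
  lra.
(* The arcs are separated: cut the first interval after [k] and the second before [l], then induct
   on the pieces [i,k] and [i',l[. *)
have [kl|lk] := ltnP k l.
  have := IH i i' k.+1 l ltac:(side) ltac:(side) ltac:(side) ltac:(side)
    ltac:(side) ltac:(side) ltac:(side).
  have := @v_cat i l j'.+1 ltac:(side) ltac:(side) ltac:(side) ltac:(side).
  have := @v_cat i' k.+1 j ltac:(side) ltac:(side) ltac:(side) ltac:(side).
  lra.
(* Here [i < l < k < j'], equality of [l] and [k] being excluded by parity. The crossing arcs are
   exchanged for the nested {i,j'} and {l,k}, with induction on the interiors [i+1,k[ and
   [l+1,j'[. *)
have nlk : l != k by apply/eqP => elk; move: pk; rewrite -elk pl pi; case: odd.
have := IH i.+1 l.+1 k j' ltac:(side) ltac:(side) ltac:(side) ltac:(side)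
  ltac:(side) ltac:(side) ltac:(side).
have := @c_cross i l k j' ltac:(side) ltac:(side) ltac:(side).
have := @v_arc i j' ltac:(side) ltac:(side) ltac:(side).
have := @v_arc l k ltac:(side) ltac:(side) ltac:(side).
have := @v_cat i' k.+1 j ltac:(side) ltac:(side) ltac:(side) ltac:(side).
have := @v_cat i' l k.+1 ltac:(side) ltac:(side) ltac:(side) ltac:(side).
lra.
Qed.

(** Adjacent points are left out: for [j = i.+1] the bounds of [v i.+2 j.-1] would be reversed, a
    case governed by the initial conditions of [W]. *)
Lemma v_min i j : (1 <= i)%N -> (i.+1 < j < N)%N -> odd j = ~~ odd i ->
  v i j.+1 = Num.min (c i j + v i.+1 j)
                     (v i j.-1 + v i.+2 j.+1 - v i.+2 j.-1).
Proof.
case: j => // j i1 ij pij; apply/le_anti; rewrite le_min ge_min /=.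
have nij : i.+1 != j.
  by apply/eqP => eij; move: pij; rewrite -eij /= negbK; case: odd.
rewrite v_arc //=; try side.
have := @v_quadrangle i i.+2 j j.+2 ltac:(side) ltac:(side) ltac:(side)
  ltac:(side) ltac:(side) ltac:(side).
rewrite -lerBrDr => -> /=.
have [k [hk pk lek]] := @v_first i j.+2 ltac:(side) ltac:(side) ltac:(side).
have [ekj|nkj] := eqVneq k j.+1.
  by move: lek; rewrite ekj v_empty addr0 => ->.
have nkj' : k != j.
  by apply/eqP => ekj; move: pij; rewrite -ekj /= pk; case: odd.
apply/orP; right.
have := @v_quadrangle i i.+2 k.+1 j ltac:(side) ltac:(side) ltac:(side)
  ltac:(side) ltac:(side) ltac:(side).
have := @v_cat i.+2 k.+1 j.+2 ltac:(side) ltac:(side) ltac:(side) ltac:(side).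
have := @v_arc i k ltac:(side) ltac:(side) ltac:(side).
lra.
Qed.

End IntervalRecursion.

(** * Matchings on intervals of consecutive points *)

Section Points.
Variables (R : realType) (x : nat -> R) (N : nat).
Hypothesis x_incr : forall k l, (1 <= k)%N -> (k < l)%N -> (l < N)%N -> x k < x l.
Local Open Scope fset_scope.

(* The points of index in [i, j[; with this half-open convention the bounds of
   an interval carrying a perfect matching have the same parity. *)
Definition points_itv i j : {fset R} := [fset x k | k in index_iota i j].

Lemma points_itvP i j t :
  reflect (exists2 k, (i <= k < j)%N & t = x k) (t \in points_itv i j).
Proof.
by apply: (iffP (imfsetP _ _ _ _)) => -[k]; rewrite /= ?mem_index_iota => ??;
  exists k; rewrite /= ?mem_index_iota.
Qed.

Lemma points_itv0 i : points_itv i i = fset0.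
Proof.
apply/fsetP => t; rewrite inE; apply/negbTE/points_itvP => -[k ik _].
by lia.
Qed.

Lemma x_mono k l : (1 <= k < N)%N -> (1 <= l < N)%N -> (x k < x l) = (k < l)%N.
Proof.
move=> hk hl; have [kl|lk|->] := ltngtP k l; last by rewrite ltxx.
  by apply: x_incr; lia.
by apply/negbTE; rewrite -leNgt ltW // x_incr //; lia.
Qed.

Lemma x_inj k l : (1 <= k < N)%N -> (1 <= l < N)%N -> x k = x l -> k = l.
Proof.
move=> hk hl e; have := x_mono k l hk hl; have := x_mono l k hl hk.
by rewrite e ltxx; case: ltngtP.
Qed.

Lemma mem_points_itv i j k : (1 <= i)%N -> (j <= N)%N -> (1 <= k < N)%N ->
  (x k \in points_itv i j) = (i <= k < j)%N.
Proof.
move=> i1 jN hk; apply/points_itvP/idP => [[l hl /x_inj ->//]|]; first by lia.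
by exists k.
Qed.

Lemma card_points_itv i j : (1 <= i)%N -> (j <= N)%N ->
  #|` points_itv i j| = (j - i)%N.
Proof.
move=> i1 jN; rewrite card_in_imfset /=; last first.
  by move=> k l; rewrite !mem_index_iota => hk hl; apply: x_inj; lia.
by rewrite undup_id ?iota_uniq // size_iota.
Qed.

Lemma odd_card_points_itv i j : (1 <= i <= j)%N -> (j <= N)%N ->
  odd #|` points_itv i j| = (odd j != odd i).
Proof.
by move=> hi jN; rewrite card_points_itv ?oddB; [case: odd; case: odd|lia..].
Qed.

Lemma points_itv_cat i k j : (i <= k <= j)%N ->
  points_itv i j = points_itv i k `|` points_itv k j.
Proof.
move=> hk; apply/fsetP => t; rewrite inE; apply/points_itvP/orP.
  move=> [l hl ->]; have [lk|kl] := ltnP l k; [left|right];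
  by apply/points_itvP; exists l => //; lia.
by move=> [] /points_itvP[l hl ->]; exists l => //; lia.
Qed.

Lemma points_itv_disjoint i k j : (1 <= i <= k)%N -> (k <= j <= N)%N ->
  [disjoint points_itv i k & points_itv k j].
Proof.
move=> hi hk; apply/fdisjointP => _ /points_itvP[l hl ->].
by rewrite mem_points_itv; lia.
Qed.

Lemma points_itv_arc i j : (i < j)%N ->
  points_itv i j.+1 = [fset x i; x j] `|` points_itv i.+1 j.
Proof.
move=> ij; apply/fsetP => t; rewrite !inE; apply/points_itvP/idP.
  move=> [l hl ->]; have [->|li] := eqVneq l i; first by rewrite eqxx.
  have [->|lj] := eqVneq l j; first by rewrite eqxx orbT.
  by apply/orP; right; apply/points_itvP; exists l => //; lia.
case/orP => [/orP[]/eqP ->|/points_itvP[l hl ->]];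
  [exists i|exists j|exists l] => //; lia.
Qed.

Variable d : R -> R -> R.
Local Notation v i j := (min_weight d (points_itv i j)).

Lemma min_weight_cat i k j : (1 <= i <= k)%N -> (k <= j <= N)%N ->
  odd k = odd i -> odd j = odd i -> v i j <= (v i k + v k j)%R.
Proof.
move=> hi hk pk pj; rewrite (points_itv_cat i k j); last by lia.
by apply: min_weightU; [apply: points_itv_disjoint|rewrite odd_card_points_itv ?pj ?pk ?eqxx..]; lia.
Qed.

Lemma min_weight_arc i j : (1 <= i <= j)%N -> (j < N)%N ->
  odd j = ~~ odd i -> v i j.+1 <= (d (x i) (x j) + v i.+1 j)%R.
Proof.
move=> hi jN pij; have ij : (i < j)%N.
  rewrite ltn_neqAle (andP hi).2 andbT; apply/eqP => eij.
  by move: pij; rewrite eij; case: odd.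
rewrite points_itv_arc //; have xij : x i < x j by apply: x_incr; lia.
apply: le_trans (min_weightU _ _ _ _ _ _ _) _.
- apply/fdisjointP => t; rewrite !inE => /orP[] /eqP ->.
    by rewrite mem_points_itv; lia.
  by rewrite mem_points_itv; lia.
- by rewrite cardfs2 (lt_eqF xij).
- by rewrite odd_card_points_itv ?pij /= ?eqxx; lia.
- by rewrite lerD2r min_weight_pair.
Qed.

Hypothesis d_cross : forall a c b e, a < c -> c < b -> b < e ->
  (d a e + d c b <= d a b + d c e)%R.

(** The least point [x i] lies on some arc of an optimal matching; once that arc is uncrossed, the
    points inside it and those beyond it form index intervals. *)
Lemma min_weight_first i j : (1 <= i < j)%N -> (j <= N)%N -> odd j = odd i ->
  exists k, [/\ (i < k < j)%N, odd k = ~~ odd i &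
    (d (x i) (x k) + v i.+1 k + v k.+1 j)%R <= v i j].
Proof.
move=> hi jN pij.
have ev : ~~ odd #|` points_itv i j| by rewrite odd_card_points_itv ?pij ?eqxx; lia.
have [M hM <-] := min_weight_attained R d _ ev.
have xle t : t \in points_itv i j -> x i <= t.
  case/points_itvP => l hl ->; have [->|il] := eqVneq l i; first exact: lexx.
  by rewrite ltW // x_incr; lia.
have xi : x i \in points_itv i j by rewrite mem_points_itv; lia.
have [A AM iA] : exists2 A, A \in M & x i \in A.
  move: xi; case/and3P: hM => /eqP <- _ _ /bigfcupP[A].
  by rewrite andbT; exists A.
have [a [b [ab eA aS _]]] := perfect_matching_arc _ _ _ _ hM AM.
have eai : a = x i.
  apply/eqP; move: iA; rewrite eA !inE => /orP[/eqP->//|/eqP eb].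
  by have := xle _ aS; rewrite eb leNgt ab.
rewrite eA eai in AM; rewrite eai in ab.
have [e] := min_weight_first_arc _ _ d_cross _ _ _ _ hM AM ab xle.
move=> [] /points_itvP[k hk ->].
rewrite x_mono; [|lia|lia] => ik.
have -> : [fset t in points_itv i j | x i < t < x k] = points_itv i.+1 k.
  apply/fsetP => t; rewrite !inE; apply/andP/points_itvP.
    move=> [/points_itvP[l hl ->]]; rewrite !x_mono; [|lia..].
    by exists l.
  move=> [l hl ->]; rewrite mem_points_itv ?x_mono; lia.
have -> : [fset t in points_itv i j | x k < t] = points_itv k.+1 j.
  apply/fsetP => t; rewrite !inE; apply/andP/points_itvP.
    move=> [/points_itvP[l hl ->]]; rewrite !x_mono; [|lia..].
    by exists l => //; lia.
  move=> [l hl ->]; rewrite mem_points_itv ?x_mono; lia.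
move=> oI oO hle; exists k; split=> //; first by lia.
(* The even number of points strictly inside the arc forces [k] and [i] to have opposite parity. *)
by move: oI; rewrite odd_card_points_itv /=; [case: odd; case: odd|lia..].
Qed.

End Points.

(** * Concavity of the cost, and transfer of the recursion to [W] *)

Lemma concave_cross (R : realType) (g : R -> R) :
  concave_function `[0, +oo[%classic g ->
  forall a c b e, a < c -> c < b -> b < e ->
  dist_of g a e + dist_of g c b <= dist_of g a b + dist_of g c e.
Proof.
move=> gc a c b e ac cb be; rewrite /dist_of.
rewrite !ler0_norm; [|lra..].
(* The shortest and longest lengths [s] and [l] satisfy [s + l = p + q]. With
   [t = (p - s) / (l - s)], [p] is the mean of [l] and [s] with weights [t] and [1 - t], and [q] the
   mean with the weights swapped; the two concavity inequalities add up to the claim. *)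
set s := - (c - b); set l := - (a - e); set p := - (a - b); set q := - (c - e).
have sl : 0 < l - s by rewrite /l /s; lra.
have t0 : 0 <= (p - s) / (l - s) by apply: divr_ge0; rewrite /l /s /p; lra.
have t1 : (p - s) / (l - s) <= 1.
  by rewrite ler_pdivrMr // mul1r /l /s /p; lra.
have s_in : (s : R^o) \in `[0, +oo[%classic by rewrite inE /= in_itv /= andbT /s; lra.
have l_in : (l : R^o) \in `[0, +oo[%classic by rewrite inE /= in_itv /= andbT /l; lra.
have := gc (Itv01 t0 t1) l s l_in s_in.
have := gc (Itv01 t0 t1) s l s_in l_in.
have convE (T : {i01 R}) (y z : convex_lmodType R^o) :
  conv T y z = T%:num * (y : R) + unstable.onem T%:num * (z : R) := convRE y z T.
rewrite !convE !convRE /=.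
set t := (p - s) / (l - s) in t0 t1 *.
have tE : t * l - t * s = p - s by rewrite -mulrBr /t divfK // gt_eqF.
have qE : q = l + s - p by rewrite /q /l /s /p; lra.
have -> : t * s + unstable.onem t * l = q.
  by rewrite /unstable.onem mulrBl mul1r qE; lra.
have -> : t * l + unstable.onem t * s = p.
  by rewrite /unstable.onem mulrBl mul1r; lra.
rewrite /unstable.onem !mulrBl !mul1r !mulrN; lra.
Qed.

(** The convention W(i,i-1) = 0 agrees with the minimum weight on the empty set, so only W(i+2,i-1)
    falls outside this form. *)
Lemma W_points_itv (R : realType) (d : R -> R -> R) (x : nat -> R) i j :
  (i <= j.+1)%N -> i != j -> W d x i j = min_weight d (points_itv R x i j.+1).
Proof.
rewrite /W; case: ltngtP => // ji ij _; have -> : i = j.+1 by lia.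
by rewrite eqxx points_itv0 min_weight0.
Qed.

Theorem theorem6 (R : realType) (g : R -> R)
    (g_ge0 : forall t : R, 0 <= t -> 0 <= g t)
    (g_concave : concave_function `[0, +oo[%classic g)
    (g_eq0 : forall t : R, 0 <= t -> (g t = 0 <-> t = 0))
    (n : nat) (n_ge1 : (1 <= n)%N) (x : nat -> R)
    (x_incr : forall k l : nat, (1 <= k)%N -> (k < l)%N -> (l <= 2 * n)%N ->
       x k < x l)
    (i j : nat) (i_ge1 : (1 <= i)%N) (ltij : (i < j)%N) (j_le : (j <= 2 * n)%N)
    (parity : odd i != odd j) :
  let d := dist_of g in
  W d x i j =
    Num.min (d (x i) (x j) + W d x (i + 1) (j - 1))
            (W d x i (j - 2) + W d x (i + 2) j - W d x (i + 2) (j - 2)).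
Proof.
move=> d; pose N := (2 * n).+1.
have incr k l : (1 <= k)%N -> (k < l)%N -> (l < N)%N -> x k < x l.
  by move=> k1 kl lN; apply: x_incr.
have pij : odd j = ~~ odd i by move: parity; case: odd; case: odd.
have d_cross := concave_cross R g g_concave.
have v_arc := min_weight_arc R x N incr d.
have v_first := min_weight_first R x N incr d d_cross.
(* For adjacent points the initial conditions make both terms of the minimum equal to
   [d (x i) (x j)]. *)
have [eij|nij] := eqVneq j i.+1.
  have -> : W d x i j = d (x i) (x j).
    rewrite eij W_points_itv; [|lia..].
    have [k [ik _ hk]] := v_first i i.+2 ltac:(lia) ltac:(lia) ltac:(side).
    have ek : k = i.+1 by lia.
    have := v_arc i i.+1 ltac:(lia) ltac:(lia) ltac:(side).
    by move: hk; rewrite ek !points_itv0 !min_weight0; lra.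
  have -> : W d x i (j - 2) = 0.
    by rewrite -(W_pred d x i_ge1); congr W; lia.
  have -> : W d x (i + 2) j = 0.
    by rewrite -(W_pred d x (_ : 0 < i + 2)%N); [congr W|]; lia.
  have -> : W d x (i + 1) (j - 1) = 0.
    by rewrite -(W_pred d x (_ : 0 < i + 1)%N); [congr W|]; lia.
  have -> : W d x (i + 2) (j - 2) = - d (x i) (x j).
    by rewrite eij -[i.+1 in RHS]addn1 -W_init //; congr W; lia.
  by rewrite !addr0 add0r opprK minxx.
(* By parity [j] is now at least [i + 3], so every pair of indices bounds a nonempty interval or,
   for (i+2, j-2), possibly an empty one. *)
rewrite !W_points_itv; try lia.
have -> : (i + 1 = i.+1)%N by lia.
have -> : (i + 2 = i.+2)%N by lia.
have -> : (j - 1).+1 = j by lia.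
have -> : (j - 2).+1 = j.-1 by lia.
apply: (v_min R (fun i j => min_weight d (points_itv R x i j))
  (fun i j => d (x i) (x j)) N); try lia.
- by move=> k; rewrite points_itv0 min_weight0.
- exact: min_weight_cat.
- exact: v_arc.
- exact: v_first.
- by move=> k l k' l' *; apply: d_cross; apply: incr; lia.
Qed.
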